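(* Let $G$ be a finite abelian group, fix $q>2$, and let $\Phi\subset G$ be a nonempty set of density $\delta:=|\Phi|/|G|$ satisfying $$\max_{\gamma\in\hat G,\gamma\ne1}\Big|\sum_{x\in\Phi}\gamma(x)\Big|\le\delta^{\frac{4}{q-2}}|\Phi|.$$ Then there is a constant $C_q$ depending only on $q$ such that for every $f:G\to\mathbb{C}$ with $|f(x)|\le1$ for all $x$ and $\{x:f(x)\ne0\}\subset\Phi$, $$\mathbb{E}_{\gamma\in\hat G}|\hat f(\gamma)|^q\le C_q\,\|\hat f\|_\infty^{\frac{q-2}{2}}|\Phi|^{\frac{q+2}{2}}|G|^{-1}.$$ In particular $$\frac{\|\hat f\|_q}{\|\hat 1_\Phi\|_q}\le C_q'\Big(\frac{\|\hat f\|_\infty}{\|\hat 1_\Phi\|_\infty}\Big)^{\frac{q-2}{2q}}$$ for a constant $C_q'$ depending only on $q$.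
   Context: $\hat G$ is the group of characters of $G$ (homomorphisms to the unit circle), $1$ the trivial character. $\hat f(\gamma):=\sum_{x\in G}f(x)\overline{\gamma(x)}$; $\|\hat f\|_q:=(\mathbb{E}_{\gamma\in\hat G}|\hat f(\gamma)|^q)^{1/q}$ (uniform probability measure on $\hat G$) and $\|\hat f\|_\infty:=\max_{\gamma\in\hat G}|\hat f(\gamma)|$. *)

(* Defs.v *)
From HB Require Import structures.
From mathcomp Require Import all_boot all_order all_algebra.
From mathcomp Require Import complex.
From mathcomp Require Import reals exp.

Set Implicit Arguments.
Unset Strict Implicit.
Unset Printing Implicit Defensive.

Import Order.TTheory GRing.Theory Num.Theory.
Local Open Scope ring_scope.
Local Open Scope complex_scope.

(* The modulus with values in R; in R[i] itself, `|z| = (cmod z)%:C. *)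
Notation cmod := ComplexField.Normc.normc.

Definition is_char (R : realType) (G : finZmodType) (chi : {ffun G -> R[i]}) :=
  [forall x, forall y, chi (x + y) == chi x * chi y]
  && [forall x, cmod (chi x) == 1].

Record dual (R : realType) (G : finZmodType) :=
  Char { char_fun :> {ffun G -> R[i]}; charP : is_char char_fun }.

HB.instance Definition _ (R : realType) (G : finZmodType) :=
  [isSub for @char_fun R G].
HB.instance Definition _ (R : realType) (G : finZmodType) :=
  [Choice of dual R G by <:].

(* Characters take values in the roots of X^|G| - 1, so that there are
   finitely many of them. *)
Section Finiteness.
Variables (R : realType) (G : finZmodType).
Implicit Types gamma : dual R G.

Definition char_roots : seq R[i] :=
  sval (closed_field_poly_normal ('X^(#|G|) - 1 : {poly R[i]})).

Lemma charD gamma x y : gamma (x + y) = gamma x * gamma y.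
Proof. by case: gamma => f /= /andP[/forallP/(_ x)/forallP/(_ y)/eqP]. Qed.

Lemma cmod_char gamma x : cmod (gamma x) = 1.
Proof. by case: gamma => f /= /andP[_ /forallP/(_ x)/eqP]. Qed.

Lemma char_neq0 gamma x : gamma x != 0.
Proof.
apply/eqP => h; have := cmod_char gamma x.
by rewrite h ComplexField.Normc.normc0 => /eqP; rewrite eq_sym oner_eq0.
Qed.

Lemma char_exp_card gamma x : gamma x ^+ #|G| = 1.
Proof.
have P0 : \prod_y gamma y != 0 by apply/prodf_neq0 => y _; exact: char_neq0.
apply: (mulIf P0); rewrite mul1r [in RHS](reindex_inj (addrI x)) /=.
under [in RHS]eq_bigr do rewrite charD.
by rewrite big_split /= prodr_const.
Qed.

Lemma char_in_roots gamma x : gamma x \in char_roots.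
Proof.
have G0 : (0 < #|G|)%N by apply/card_gt0P; exists 0.
rewrite /char_roots; case: closed_field_poly_normal => rs /= Drs.
rewrite -root_prod_XsubC.
have p_monic : 'X^#|G| - 1 \is @monic R[i] by rewrite monicXnsubC.
move: Drs; rewrite (monicP p_monic) scale1r => <-.
by rewrite rootE !hornerE char_exp_card subrr.
Qed.

Definition char_code gamma : {ffun G -> 'I_(size char_roots).+1} :=
  [ffun x => inord (index (gamma x) char_roots)].

Definition char_decode (h : {ffun G -> 'I_(size char_roots).+1}) :
  option (dual R G) := insub [ffun x => char_roots`_(h x)].

Lemma char_codeK : pcancel char_code char_decode.
Proof.
move=> gamma; rewrite /char_decode.
suff -> : [ffun x => char_roots`_(char_code gamma x)] = char_fun gamma.
  exact: valK.
apply/ffunP => x; rewrite !ffunE inordK ?ltnS ?index_size //.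
by rewrite nth_index // char_in_roots.
Qed.

End Finiteness.

HB.instance Definition _ (R : realType) (G : finZmodType) :=
  PCanIsCountable (@char_codeK R G).
HB.instance Definition _ (R : realType) (G : finZmodType) :=
  isFinite.Build (dual R G) (pcan_enumP (@char_codeK R G)).

Fact triv_char_subproof (R : realType) (G : finZmodType) :
  is_char [ffun _ : G => 1 : R[i]].
Proof.
apply/andP; split; apply/forallP => x.
  by apply/forallP => y; rewrite !ffunE mulr1.
by rewrite ffunE ComplexField.Normc.normc1.
Qed.

Definition triv_char (R : realType) (G : finZmodType) : dual R G :=
  Char (triv_char_subproof R G).

Section Fourier.
Variables (R : realType) (G : finZmodType).

Definition expect_dual (F : dual R G -> R) : R :=
  (\sum_gamma F gamma) / #|{: dual R G}|%:R.

Definition fhat (f : G -> R[i]) (gamma : dual R G) : R[i] :=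
  \sum_x f x * (gamma x)^*.

Definition fhat_norm (q : R) (f : G -> R[i]) : R :=
  expect_dual (fun gamma => cmod (fhat f gamma) `^ q) `^ q^-1.

(* The default value 0 of the maximum is harmless: the dual is nonempty and
   the moduli are nonnegative. *)
Definition fhat_norm_oo (f : G -> R[i]) : R :=
  \big[Num.max/0]_gamma cmod (fhat f gamma).

Definition indic (Phi : {set G}) (x : G) : R[i] := (x \in Phi)%:R.

Definition density (Phi : {set G}) : R := #|Phi|%:R / #|G|%:R.

(* For trivial G the maximum ranges over the empty set and is 0. *)
Definition max_nontriv_sum (Phi : {set G}) : R :=
  \big[Num.max/0]_(gamma : dual R G | gamma != triv_char R G)
    cmod (\sum_(x in Phi) gamma x).

End Fourier.

(* Main.v *)
(* With F = fhat f and P = |Phi|, a TT* (large sieve) argument gives, for every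
   set A of characters,
     (sum_A |F|^2)^2 <= P (P sum_A |F|^2 + eta P (sum_A |F|)^2),
   where eta bounds the normalized nontrivial character sums over Phi.
   Taking for A the set where |F| is at least sqrt(2 eta) P absorbs the last
   term and yields sum_A |F|^2 <= 2 P^2; on the complement Bessel's inequality
   sum |F|^2 <= P |G| suffices.  Writing |F|^q = |F|^2 |F|^(q-2) and bounding
   half of the exponent q-2 by the maximum M of |F|, and the other half by P on
   A and by sqrt(2 eta) P off A, gives a bound by M^((q-2)/2) P^((q+2)/2) as
   eta = delta^(4/(q-2)).  Normalizing needs that G has at least |G|
   characters. *)
Require Import Defs.
From mathcomp Require Import all_boot all_order all_algebra.
From mathcomp Require Import all_fingroup all_field all_character.
From mathcomp Require Import complex.
From mathcomp Require Import reals exp.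
From mathcomp Require Import ring lra.

Import Order.TTheory GRing.Theory Num.Theory.
Local Open Scope ring_scope.
Local Open Scope complex_scope.

(** * Real-valued modulus of complex numbers and Cauchy-Schwarz *)

Section Modulus.
Variable R : realType.
Implicit Types z : R[i].

Lemma cmodE z : `|z| = (cmod z)%:C.
Proof. by rewrite normc_def; case: z. Qed.

Lemma cmod_ge0 z : 0 <= cmod z.
Proof. by rewrite -lecR -cmodE normr_ge0. Qed.

Lemma cmodJ z : cmod (z^*)%R = cmod z.
Proof. by apply: complexI; rewrite -!cmodE norm_conjC. Qed.

Lemma cmodM z z' : cmod (z * z') = cmod z * cmod z'.
Proof. exact: ComplexField.Normc.normcM. Qed.

Lemma cmod_real (a : R) : 0 <= a -> cmod a%:C = a.
Proof. by move=> a0; apply: complexI; rewrite -cmodE ger0_norm ?lecR. Qed.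

Lemma mul_conjc z : z * z^* = (cmod z ^+ 2)%:C.
Proof. by rewrite -normCK cmodE -rmorphXn. Qed.

Lemma cmod_sum (I : finType) (P : pred I) (F : I -> R[i]) :
  cmod (\sum_(i | P i) F i) <= \sum_(i | P i) cmod (F i).
Proof.
rewrite -lecR -cmodE (rmorph_sum (real_complex R)).
by apply: le_trans (ler_norm_sum _ _ _) _; apply: ler_sum => i _; rewrite cmodE.
Qed.

(** Cauchy-Schwarz against the constant 1: expand the square and apply
    [a i * a j <= (a i ^+ 2 + a j ^+ 2) / 2] to each pair. *)
Lemma sqr_sum_le_card (I : finType) (A : {set I}) (a : I -> R) :
  (\sum_(i in A) a i) ^+ 2 <= #|A|%:R * \sum_(i in A) a i ^+ 2.
Proof.
rewrite expr2 big_distrlr /=.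
have le2 : \sum_(i in A) \sum_(j in A) a i * a j <=
    \sum_(i in A) \sum_(j in A) (a i ^+ 2 + a j ^+ 2) / 2.
  apply: ler_sum => i _; apply: ler_sum => j _.
  by have := sqr_ge0 (a i - a j); lra.
apply: le_trans le2 _; rewrite le_eqVlt; apply/orP; left; apply/eqP.
have inner i : \sum_(j in A) (a i ^+ 2 + a j ^+ 2) / 2 =
    #|A|%:R / 2 * a i ^+ 2 + (\sum_(j in A) a j ^+ 2) / 2.
  by rewrite -mulr_suml big_split /= sumr_const -mulr_natl; ring.
rewrite (eq_bigr _ (fun i _ => inner i)) big_split /= -mulr_sumr sumr_const.
by rewrite -mulr_natl; field.
Qed.

End Modulus.

(** * Orthogonality of characters and the size of the dual group *)

Section DualGroup.
Variables (R : realType) (G : finZmodType).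
Implicit Types gamma : dual R G.

Lemma char_quot_subproof gamma gamma' :
  is_char [ffun x => gamma x * (gamma' x)^*].
Proof.
apply/andP; split; apply/forallP => x.
  by apply/forallP => y; rewrite !ffunE !charD rmorphM mulrACA.
by rewrite ffunE cmodM cmodJ !cmod_char mulr1.
Qed.

Definition char_quot gamma gamma' : dual R G :=
  Char (char_quot_subproof gamma gamma').

Lemma char_quot_neq_triv gamma gamma' :
  gamma != gamma' -> char_quot gamma gamma' != triv_char R G.
Proof.
apply: contraNneq => /(congr1 (@char_fun R G)) /ffunP e; apply/eqP/val_inj.
apply/ffunP => x; have := e x; rewrite !ffunE => /(congr1 ( *%R^~ (gamma' x))).
by rewrite -mulrA (mulrC _^*) mul_conjc cmod_char expr1n mulr1 mul1r.
Qed.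

(** Translating the sum by a point [a] with [gamma a != 1] multiplies it by [gamma a] but leaves it
    unchanged. *)
Lemma sum_char_eq0 gamma : gamma != triv_char R G -> \sum_x gamma x = 0.
Proof.
move=> ntriv; have [a a_neq1] : exists a, gamma a != 1.
  apply/existsP; apply: contraNT ntriv => /existsPn e1.
  by apply/eqP/val_inj/ffunP => x; rewrite ffunE; apply/eqP/negPn.
apply/eqP; have : (gamma a - 1) * \sum_x gamma x = 0.
  rewrite mulrBl mul1r mulr_sumr [X in _ - X](reindex_inj (addrI a)) /=.
  by under [X in _ - X]eq_bigr do rewrite charD; rewrite subrr.
by move/eqP; rewrite mulf_eq0 subr_eq0 (negPf a_neq1).
Qed.

(** In characteristic 0 the polynomial ['X^n - 1] is separable, so it has [n] distinct roots; [n]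
    distinct [n]-th roots of unity in a field include a primitive one. *)
Lemma prim_root_complex (n : nat) :
  (0 < n)%N -> {z : R[i] | n.-primitive_root z}.
Proof.
pose p : {poly R[i]} := 'X^n - 1; have [r Dp] := closed_field_poly_normal p.
move=> n_gt0; apply/sigW; rewrite (monicP _) ?monicXnsubC // scale1r in Dp.
have rn1 : all n.-unity_root r by apply/allP => z; rewrite -root_prod_XsubC -Dp.
have sz_r : (n < (size r).+1)%N.
  by rewrite -(size_prod_XsubC r id) -Dp size_XnsubC.
have [|z] := hasP (cyclic.has_prim_root n_gt0 rn1 _ sz_r); last by exists z.
by rewrite -separable_prod_XsubC -Dp separable_Xn_sub_1 // pnatr_eq0 -lt0n.
Qed.

(* The irreducible characters of G take values in the algebraic numbers; they
   are transported to R[i] by matching primitive roots of unity. *)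
Lemma card_dual_ge : (#|G| <= #|{: dual R G}|)%N.
Proof.
have n_gt0 : (0 < #|G|)%N by apply/card_gt0P; exists 0.
have [w w_prim] := prim_root_complex _ n_gt0.
have [z z_prim] := C_prim_root_exists n_gt0.
pose gT : finGroupType := G.
have abG : abelian [set: gT] by apply/centsP => x _ y _; apply: addrC.
have lin (i : Iirr [set: gT]) : ('chi_i)%R \is a linear_char.
  exact: (char_abelianP _ abG).
have chi_pow (i : Iirr [set: gT]) (x : gT) :
    exists k : 'I_#|G|, 'chi_i x == z ^+ k.
  have chi1 : 'chi_i x ^+ #|G| = 1.
    by rewrite -lin_charX ?inE // -cardsT cyclic.expg_cardG ?inE // lin_char1.
  by have [k ->] := prim_rootP z_prim chi1; exists k.
(* A discrete logarithm of ['chi_i x] to the base [z]. *)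
pose lg i x := xchoose (chi_pow i x).
have chiE i x : 'chi_i x = z ^+ lg i x by apply/eqP/(xchooseP (chi_pow i x)).
(* Since [w] and [z] have the same order, two powers of [w] agree exactly when the same powers of
   [z] do; this carries over multiplicativity here and injectivity below. *)
have char_i i : is_char [ffun x : G => w ^+ lg i x].
  apply/andP; split; apply/forallP => x.
    apply/forallP => y; rewrite !ffunE -exprD (eq_prim_root_expr w_prim).
    rewrite -(eq_prim_root_expr z_prim) exprD -!chiE.
    by rewrite -lin_charM ?inE.
  rewrite ffunE -(@pexpr_eq1 _ _ #|G|) ?cmod_ge0 -?lt0n //.
  have cmodX u n : cmod (u ^+ n) = cmod u ^+ n :> R.
    by elim: n => [|n IHn]; rewrite ?ComplexField.Normc.normc1 // !exprS cmodM IHn.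
  by rewrite -cmodX exprAC (prim_expr_order w_prim) expr1n ComplexField.Normc.normc1.
pose h i := Char (char_i i).
have h_inj : injective h.
  move=> i j /(congr1 (@char_fun R G)) /ffunP e; apply: irr_inj.
  apply/cfunP => x; have /eqP := e x; rewrite !ffunE (eq_prim_root_expr w_prim).
  by rewrite -(eq_prim_root_expr z_prim) -!chiE => /eqP.
by have := leq_card _ h_inj; rewrite card_Iirr_abelian // cardsT.
Qed.

End DualGroup.

(** * Large sieve, Bessel's inequality and the large spectrum *)

Section LargeSieve.
Variables (R : realType) (G : finZmodType) (f : G -> R[i]) (Phi : {set G}).
Hypothesis f_le1 : forall x, cmod (f x) <= 1.
Hypothesis f_supp : forall x, f x != 0 -> x \in Phi.

Lemma sum_cmod_mul_le (h : G -> R[i]) :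
  cmod (\sum_x f x * h x) <= \sum_(x in Phi) cmod (h x).
Proof.
apply: le_trans (cmod_sum _ _ _ _) _; rewrite [leRHS]big_mkcond /=.
apply: ler_sum => x _; rewrite cmodM; case: ifPn => [_|xNPhi].
  by rewrite ler_piMl ?cmod_ge0.
by rewrite (eqP (contraNT (f_supp x) xNPhi)) ComplexField.Normc.normc0 mul0r.
Qed.

Lemma cmod_fhat_le (gamma : dual R G) : cmod (fhat f gamma) <= #|Phi|%:R.
Proof.
apply: le_trans (sum_cmod_mul_le _) _.
by under eq_bigr do rewrite cmodJ cmod_char; rewrite sumr_const.
Qed.

(* Duality: the left-hand side is the square of the pairing of f with
   h = \sum_(gamma in A) fhat f gamma * gamma; Cauchy-Schwarz on Phi leaves
   the sum of |h|^2, which may be extended to Psi and then expanded. *)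
Lemma large_sieve (Psi : {set G}) (A : {set dual R G}) (mu : R) :
  Phi \subset Psi -> 0 <= mu ->
  (forall gamma, gamma != triv_char R G -> cmod (\sum_(x in Psi) gamma x) <= mu) ->
  (\sum_(gamma in A) cmod (fhat f gamma) ^+ 2) ^+ 2 <=
    #|Phi|%:R * (#|Psi|%:R * (\sum_(gamma in A) cmod (fhat f gamma) ^+ 2)
                 + mu * (\sum_(gamma in A) cmod (fhat f gamma)) ^+ 2).
Proof.
move=> sPhiPsi mu_ge0 Psi_le; set S := \sum_(gamma in A) _ ^+ 2.
have S_ge0 : 0 <= S by apply: sumr_ge0 => gamma _; apply: sqr_ge0.
pose h x := \sum_(gamma in A) fhat f gamma * gamma x.
have SE : S%:C = \sum_x f x * (h x)^*.
  rewrite (rmorph_sum (real_complex R)) /=.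
  rewrite (eq_bigr (fun gamma : dual R G =>
      \sum_x f x * (gamma x)^* * (fhat f gamma)^*)).
    rewrite exchange_big /=; apply: eq_bigr => x _.
    rewrite /h rmorph_sum mulr_sumr; apply: eq_bigr => gamma _.
    by rewrite rmorphM -mulrA (mulrC (gamma x)^*).
  by move=> gamma _; rewrite -mulr_suml -[\sum_i _]/(fhat f gamma) mul_conjc.
have S_le : S <= \sum_(x in Phi) cmod (h x).
  rewrite -[S]cmod_real // SE; apply: le_trans (sum_cmod_mul_le _) _.
  by under eq_bigr do rewrite cmodJ.
have S2_le : S ^+ 2 <= #|Phi|%:R * \sum_(x in Phi) cmod (h x) ^+ 2.
  by apply: le_trans (sqr_sum_le_card _ _ _ _); rewrite lerXn2r ?nnegrE // (le_trans S_ge0).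
apply: le_trans S2_le _; rewrite ler_wpM2l ?ler0n //.
have PhiPsi : \sum_(x in Phi) cmod (h x) ^+ 2 <= \sum_(x in Psi) cmod (h x) ^+ 2.
  rewrite [leLHS]big_mkcond [leRHS]big_mkcond /=; apply: ler_sum => x _.
  by case: ifPn => [/(subsetP sPhiPsi) ->|_] //; case: ifP => _; rewrite ?sqr_ge0.
apply: le_trans PhiPsi _; set X := \sum_(x in Psi) _.
have X_ge0 : 0 <= X by apply: sumr_ge0 => x _; apply: sqr_ge0.
have XE : X%:C = \sum_(gamma in A) \sum_(gamma' in A)
    fhat f gamma * (fhat f gamma')^* * \sum_(x in Psi) char_quot R G gamma gamma' x.
  rewrite (rmorph_sum (real_complex R)) /=.
  rewrite (eq_bigr (fun x => \sum_(gamma in A) \sum_(gamma' in A)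
      fhat f gamma * (fhat f gamma')^* * char_quot R G gamma gamma' x)).
    rewrite exchange_big /=; apply: eq_bigr => gamma _.
    by rewrite exchange_big /=; apply: eq_bigr => gamma' _; rewrite mulr_sumr.
  move=> x _; rewrite -mul_conjc /h rmorph_sum big_distrlr /=.
  apply: eq_bigr => gamma _; apply: eq_bigr => gamma' _.
  by rewrite ffunE rmorphM mulrACA.
(* The diagonal contributes at most [#|Psi|] and the rest at most [mu]. Allowing [mu] on the
   diagonal too lets the error terms add up to a full square. *)
have T_le gamma gamma' : cmod (\sum_(x in Psi) char_quot R G gamma gamma' x) <=
    (gamma' == gamma)%:R * #|Psi|%:R + mu.
  have [->|neq] := eqVneq gamma' gamma; last first.
    by rewrite mul0r add0r Psi_le // char_quot_neq_triv // eq_sym.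
  rewrite mul1r ler_wpDr //; apply: le_trans (cmod_sum _ _ _ _) _.
  by under eq_bigr do rewrite cmod_char; rewrite sumr_const.
rewrite -[X]cmod_real // XE; apply: le_trans (cmod_sum _ _ _ _) _.
rewrite mulr_sumr expr2 mulr_suml mulr_sumr -big_split /=.
apply: ler_sum => gamma gammaA; apply: le_trans (cmod_sum _ _ _ _) _.
have -> : #|Psi|%:R * cmod (fhat f gamma) ^+ 2 =
    \sum_(gamma' in A) cmod (fhat f gamma) * cmod (fhat f gamma') *
      ((gamma' == gamma)%:R * #|Psi|%:R).
  rewrite (bigD1 gamma) //= eqxx big1 ?addr0 ?mul1r; first by rewrite mulrC expr2.
  by move=> gamma' /andP[_ /negPf ->]; rewrite mul0r mulr0.
rewrite !mulr_sumr -big_split /=; apply: ler_sum => gamma' _.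
rewrite !cmodM cmodJ.
apply: le_trans (ler_wpM2l _ (T_le gamma gamma')) _; first by rewrite mulr_ge0 ?cmod_ge0.
by rewrite le_eqVlt; apply/orP; left; apply/eqP; ring.
Qed.

(** The large sieve with [Psi] all of [G]: orthogonality permits [mu = 0], and one factor of the sum
    cancels. *)
Lemma fhat_bessel :
  \sum_gamma cmod (fhat f gamma) ^+ 2 <= #|G|%:R * #|Phi|%:R :> R.
Proof.
have := large_sieve setT setT 0 (subsetT _) (lexx 0).
under [X in X ^+ 2 <= _]eq_bigl do rewrite inE.
under [X in _ <= _ * (_ * X + _)]eq_bigl do rewrite inE.
set S := \sum_gamma _; rewrite mul0r addr0 cardsT => le_S.
have S_ge0 : 0 <= S by apply: sumr_ge0 => gamma _; apply: sqr_ge0.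
have [->|S_neq0] := eqVneq S 0; first by rewrite mulr_ge0 ?ler0n.
have S_gt0 : 0 < S by rewrite lt_def S_neq0.
rewrite -(ler_pM2r S_gt0) -expr2 mulrAC mulrC le_S // => gamma ntriv.
under eq_bigl do rewrite inE.
by rewrite sum_char_eq0 // ComplexField.Normc.normc0.
Qed.

(* At height lam the off-diagonal part of the large sieve is at most half of
   the left-hand side. *)
Lemma large_spectrum (mu lam : R) :
  0 <= mu -> 0 <= lam -> 2 * mu * #|Phi|%:R <= lam ^+ 2 ->
  (forall gamma, gamma != triv_char R G -> cmod (\sum_(x in Phi) gamma x) <= mu) ->
  \sum_(gamma | lam <= cmod (fhat f gamma)) cmod (fhat f gamma) ^+ 2
    <= 2 * #|Phi|%:R ^+ 2.
Proof.
move=> mu_ge0 lam_ge0 lamE Phi_le.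
pose A := [set gamma : dual R G | lam <= cmod (fhat f gamma)].
rewrite (eq_bigl (fun gamma => gamma \in A)); last by move=> gamma; rewrite inE.
have := large_sieve Phi A mu (subxx _) mu_ge0 Phi_le.
set S := \sum_(gamma in A) _ ^+ 2; set T := \sum_(gamma in A) _ => le_S.
have S_ge0 : 0 <= S by apply: sumr_ge0 => gamma _; apply: sqr_ge0.
have T_ge0 : 0 <= T by apply: sumr_ge0 => gamma _; apply: cmod_ge0.
have lamT : lam * T <= S.
  rewrite mulr_sumr; apply: ler_sum => gamma; rewrite inE => lam_le.
  by rewrite expr2 ler_wpM2r ?cmod_ge0.
have lamT2 : lam ^+ 2 * T ^+ 2 <= S ^+ 2.
  by rewrite -exprMn lerXn2r ?nnegrE ?mulr_ge0.
have muT : 2 * mu * #|Phi|%:R * T ^+ 2 <= S ^+ 2.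
  by apply: le_trans lamT2; rewrite ler_wpM2r ?sqr_ge0.
have [->|S_neq0] := eqVneq S 0; first by rewrite mulr_ge0 ?sqr_ge0 ?ler0n.
have S_gt0 : 0 < S by rewrite lt_def S_neq0.
(* With P = |Phi|, the sieve gives S^2 <= P^2 S + P mu T^2 <= P^2 S + S^2 / 2. *)
rewrite -(ler_pM2r S_gt0); move: le_S muT; rewrite !expr2; lra.
Qed.

End LargeSieve.

(** * The unnormalized moment bound *)

Section Moments.
Variables (R : realType) (q : R).
Hypothesis q_gt2 : 2 < q.

(** Separates the square, to be summed, from two half powers, to be bounded pointwise. As [q > 2]
    the exponents are positive, so [x = 0] is covered. *)
Lemma powR_sqr_mul (x : R) :
  0 <= x -> x `^ q = x ^+ 2 * (x `^ ((q - 2) / 2) * x `^ ((q - 2) / 2)).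
Proof.
move=> x_ge0; have a_gt0 : 0 < (q - 2) / 2 by have := q_gt2; lra.
rewrite -powR_mulrn // -!powRD; first by congr powR; field.
  by rewrite [_ + _ == 0]gt_eqF ?addr_gt0.
by rewrite [_ + _ == 0]gt_eqF ?addr_gt0.
Qed.

Lemma le_powR_half (x y : R) :
  0 <= x -> x <= y -> x `^ ((q - 2) / 2) <= y `^ ((q - 2) / 2).
Proof.
move=> x_ge0 xy; apply: ge0_ler_powR; rewrite ?nnegrE //; last exact: le_trans xy.
by have := q_gt2; lra.
Qed.

Lemma sum_fhat_powR_le (G : finZmodType) (Phi : {set G}) (f : G -> R[i]) :
  Phi != set0 ->
  max_nontriv_sum R Phi <= density R Phi `^ (4 / (q - 2)) * #|Phi|%:R ->
  (forall x, cmod (f x) <= 1) ->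
  (forall x, f x != 0 -> x \in Phi) ->
  \sum_(gamma : dual R G) cmod (fhat f gamma) `^ q
    <= (2 + 2 `^ ((q - 2) / 4)) * fhat_norm_oo f `^ ((q - 2) / 2)
       * #|Phi|%:R `^ ((q + 2) / 2).
Proof.
move=> Phi_neq0 Phi_unif f_le1 f_supp.
set P : R := #|Phi|%:R; set N : R := #|G|%:R; set M := fhat_norm_oo f.
set a := (q - 2) / 2; set eta := density R Phi `^ (4 / (q - 2)).
have q2_neq0 : q - 2 != 0 by rewrite subr_eq0 gt_eqF.
have P_gt0 : 0 < P by rewrite ltr0n card_gt0.
have N_gt0 : 0 < N by rewrite ltr0n; apply/card_gt0P; exists 0.
have eta_ge0 : 0 <= eta by apply: powR_ge0.
(* The least height that [large_spectrum] admits for [mu = eta * P]. *)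
pose lam := (2 * eta) `^ 2^-1 * P.
have lam_ge0 : 0 <= lam by rewrite mulr_ge0 ?powR_ge0 ?ltW.
have lam2 : lam ^+ 2 = 2 * eta * P ^+ 2.
  rewrite exprMn -(powR_mulrn 2 (powR_ge0 _ _)) -powRrM mulVf ?pnatr_eq0 //.
  by rewrite powRr1 // mulr_ge0.
(* The exponent 4/(q-2) makes eta^((q-2)/4) equal to the density P/N, whose 1/N cancels the factor N
   from Bessel's inequality. *)
have lam_a : lam `^ a = 2 `^ ((q - 2) / 4) * (P / N) * P `^ a.
  rewrite powRM ?powR_ge0 ?ltW // -powRrM powRM // /eta -powRrM.
  have -> : 2^-1 * a = (q - 2) / 4 by rewrite /a; field.
  have -> : 4 / (q - 2) * ((q - 2) / 4) = 1 by field.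
  by rewrite powRr1 // /density divr_ge0 ?ler0n.
have F_ge0 gamma : 0 <= cmod (fhat f gamma) by apply: cmod_ge0.
have F_leM gamma : cmod (fhat f gamma) <= M.
  exact: (le_bigmax 0 (fun gamma => cmod (fhat f gamma))).
have F_leP gamma : cmod (fhat f gamma) <= P by apply: cmod_fhat_le.
rewrite (bigID (fun gamma : dual R G => lam <= cmod (fhat f gamma))) /=.
have large : \sum_(gamma : dual R G | lam <= cmod (fhat f gamma))
    cmod (fhat f gamma) `^ q <= 2 * P ^+ 2 * (M `^ a * P `^ a).
  have spec : \sum_(gamma : dual R G | lam <= cmod (fhat f gamma))
      cmod (fhat f gamma) ^+ 2 <= 2 * P ^+ 2.
    apply: (large_spectrum _ _ _ _ f_le1 f_supp (eta * P)) => //.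
    - by rewrite mulr_ge0 // ltW.
    - by rewrite lam2 expr2 !mulrA.
    - move=> gamma ntriv; apply: le_trans Phi_unif.
      exact: (le_bigmax_cond 0 (fun gamma : dual R G => cmod (\sum_(x in Phi) gamma x))).
  apply: le_trans (ler_wpM2r _ spec); last by rewrite mulr_ge0 ?powR_ge0.
  rewrite mulr_suml; apply: ler_sum => gamma _; rewrite powR_sqr_mul //.
  by rewrite ler_wpM2l ?sqr_ge0 // ler_pM ?powR_ge0 // le_powR_half.
have small : \sum_(gamma : dual R G | ~~ (lam <= cmod (fhat f gamma)))
    cmod (fhat f gamma) `^ q <= N * P * (M `^ a * lam `^ a).
  have bessel := fhat_bessel _ _ _ _ f_le1 f_supp.
  apply: le_trans (ler_wpM2r _ bessel); last by rewrite mulr_ge0 ?powR_ge0.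
  rewrite mulr_suml [leLHS]big_mkcond /=; apply: ler_sum => gamma _.
  case: ifPn => [|_]; last by rewrite !mulr_ge0 ?sqr_ge0 ?powR_ge0.
  rewrite -ltNge => /ltW F_lam; rewrite powR_sqr_mul //.
  by rewrite ler_wpM2l ?sqr_ge0 // ler_pM ?powR_ge0 // le_powR_half.
apply: le_trans (lerD large small) _.
have -> : P `^ ((q + 2) / 2) = P `^ a * P ^+ 2.
  rewrite -powR_mulrn ?ltW // -powRD; last by rewrite (gt_eqF P_gt0) implybT.
  by congr powR; rewrite /a; field.
rewrite lam_a le_eqVlt; apply/orP; left; apply/eqP; field.
by rewrite gt_eqF.
Qed.

End Moments.

(** * Normalization and comparison with the indicator function *)

Theorem theorem2p4 (R : realType) (q : R) (hq : 2 < q) :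
  exists C C' : R,
    forall (G : finZmodType) (Phi : {set G}),
      Phi != set0 ->
      max_nontriv_sum R Phi <= density R Phi `^ (4 / (q - 2)) * #|Phi|%:R ->
      forall f : G -> R[i],
        (forall x, cmod (f x) <= 1) ->
        (forall x, f x != 0 -> x \in Phi) ->
        expect_dual (fun gamma => cmod (fhat f gamma) `^ q)
          <= C * fhat_norm_oo f `^ ((q - 2) / 2)
               * #|Phi|%:R `^ ((q + 2) / 2) * #|G|%:R^-1
        /\ fhat_norm q f / fhat_norm q (indic R Phi)
          <= C' * (fhat_norm_oo f / fhat_norm_oo (indic R Phi))
                    `^ ((q - 2) / (2 * q)).
Proof.
pose C : R := 2 + 2 `^ ((q - 2) / 4).
have C_ge0 : 0 <= C by rewrite addr_ge0 ?powR_ge0.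
exists C, (C `^ q^-1) => G Phi Phi_neq0 Phi_unif f f_le1 f_supp.
have moment := sum_fhat_powR_le _ _ hq _ _ _ Phi_neq0 Phi_unif f_le1 f_supp.
set P : R := #|Phi|%:R; set M := fhat_norm_oo f.
set S := \sum_gamma _ in moment.
have P_gt0 : 0 < P by rewrite ltr0n card_gt0.
have G_gt0 : (0 < #|G|)%N by apply/card_gt0P; exists 0.
have D_gt0 : (0 < #|{: dual R G}|)%N by apply: leq_trans G_gt0 (card_dual_ge _ _).
have S_ge0 : 0 <= S by apply: sumr_ge0 => gamma _; apply: powR_ge0.
split.
  rewrite /expect_dual -/S; apply: ler_pM => //; first by rewrite invr_ge0 ler0n.
  by rewrite lef_pV2 ?posrE ?ltr0n // ler_nat card_dual_ge.
have M_ge0 : 0 <= M by apply: bigmax_ge_id.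
pose S1 := \sum_(gamma : dual R G) cmod (fhat (indic R Phi) gamma) `^ q.
have indic_le1 x : cmod (indic R Phi x) <= 1.
  rewrite /indic; case: (x \in Phi).
    by rewrite ComplexField.Normc.normc1.
  by rewrite ComplexField.Normc.normc0 ler01.
have indic_supp x : indic R Phi x != 0 -> x \in Phi.
  by rewrite /indic; case: (x \in Phi) => //; rewrite eqxx.
have indic_triv : cmod (fhat (indic R Phi) (triv_char R G)) = P.
  rewrite /fhat (eq_bigr (fun x => (x \in Phi)%:R)); last first.
    by move=> x _; rewrite ffunE rmorph1 mulr1.
  by rewrite -natr_sum -big_mkcond sum1_card -(rmorph_nat (real_complex R)) cmod_real ?ler0n.
(* The trivial character alone contributes P^q. *)
have S1_ge : P `^ q <= S1.
  rewrite /S1 (bigD1 (triv_char R G)) //= indic_triv ler_wpDr //.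
  by apply: sumr_ge0 => gamma _; apply: powR_ge0.
have Pq_gt0 : 0 < P `^ q by apply: powR_gt0.
have S1_gt0 : 0 < S1 by apply: lt_le_trans S1_ge.
pose M1 := fhat_norm_oo (indic R Phi).
have M1_gt0 : 0 < M1.
  apply: lt_le_trans P_gt0 _; rewrite -indic_triv.
  exact: (le_bigmax 0 (fun gamma => cmod (fhat (indic R Phi) gamma))).
have M1_le : M1 <= P.
  apply/bigmax_leP; split=> [|gamma _]; first exact: ltW.
  exact: cmod_fhat_le.
have q_gt0 : 0 < q by lra.
(* Replace [S1] by its lower bound P^q, apply the moment bound with (q+2)/2 - q = -(q-2)/2, then
   replace P by [M1 <= P] in the denominator. *)
have ratio : S / S1 <= C * (M / M1) `^ ((q - 2) / 2).
  apply: le_trans (_ : C * (M / P) `^ ((q - 2) / 2) <= _); last first.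
    rewrite ler_wpM2l // le_powR_half ?divr_ge0 ?(ltW P_gt0) //.
    by rewrite ler_wpM2l // lef_pV2 ?posrE.
  apply: le_trans (_ : S / P `^ q <= _).
    by rewrite ler_wpM2l // lef_pV2 ?posrE.
  rewrite ler_pdivrMr //; apply: le_trans moment _; rewrite -/C -/M -/P.
  rewrite powRM ?invr_ge0 ?(ltW P_gt0) // -!mulrA ler_wpM2l // ler_wpM2l ?powR_ge0 //.
  rewrite -[P^-1]powR_inv1 ?(ltW P_gt0) // -powRrM -powRD ?(gt_eqF P_gt0) ?implybT //.
  by rewrite le_eqVlt; apply/orP; left; apply/eqP; congr powR; field.
(* The size of the dual cancels between the two norms. *)
have -> : fhat_norm q f / fhat_norm q (indic R Phi) = (S / S1) `^ q^-1.
  rewrite /fhat_norm /expect_dual -/S -/S1 !powRM ?invr_ge0 ?ler0n ?(ltW S1_gt0) //.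
  rewrite -mulf_div divff ?mulr1; last by rewrite gt_eqF ?powR_gt0 ?invr_gt0 ?ltr0n.
  by rewrite -[S1^-1]powR_inv1 ?(ltW S1_gt0) // powRAC powR_inv1 ?powR_ge0.
have -> : (q - 2) / (2 * q) = (q - 2) / 2 * q^-1 by rewrite invfM mulrA.
rewrite powRrM -powRM ?powR_ge0 //; apply: ge0_ler_powR => //.
- by rewrite invr_ge0 ltW.
- by rewrite nnegrE divr_ge0 // ltW.
- by rewrite nnegrE mulr_ge0 ?powR_ge0.
Qed.
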